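(* If $T$ is a locally finite tree with countably many ends, then $\zeta(T)\le 2$.
   Context: All graphs are simple, connected, and locally finite. A ray is a one-way infinite path; two rays are equivalent if some third ray shares infinitely many vertices with each of them; an end is an equivalence class of rays. The Localization game on a graph $G$ with $k$ cops: the robber moves first, occupying a vertex; in each later robber move the robber moves to a neighboring vertex or stays put. On each cop move, the cops choose vertices $u_1,\dots,u_k$ (arbitrary) and learn the distances $d_i$ from each $u_i$ to the robber's current vertex. The cops capture the robber if after finitely many rounds they can determine the robber's vertex uniquely; otherwise the robber wins. The robber is omniscient. The localization number $\zeta(G)$ is the smallest cardinal $k$ such that $k$ cops have a winning strategy. *)

(* Defs.v *)
From mathcomp Require Import all_boot.
From mathcomp Require Import boolp classical_sets functions cardinality.

Set Implicit Arguments.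
Unset Strict Implicit.
Unset Printing Implicit Defensive.

Local Open Scope classical_set_scope.
Local Open Scope card_scope.

(* A graph is an adjacency relation on an arbitrary, possibly infinite, vertex
   type. Decidability of equality and of adjacency is no restriction here, as
   classical logic provides both. *)

Section Graphs.
Variables (V : eqType) (e : rel V).

Definition simple_graph := symmetric e /\ irreflexive e.

Definition walk_lengths (x y : V) : set nat :=
  [set n | exists p : seq V, [/\ path e x p, last x p = y & size p = n]].

Definition connected_graph :=
  [set: V] !=set0 /\ forall x y, walk_lengths x y !=set0.

Definition locally_finite := forall x, finite_set [set y | e x y].

Definition acyclic := forall c : seq V, (2 < size c)%N -> ~ ucycle e c.

Definition tree := [/\ simple_graph, connected_graph & acyclic].

(* The default value 0 is only returned when x and y are not connected. *)
Definition dist (x y : V) : nat :=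
  xget 0 [set n | walk_lengths x y n /\
                  forall m, walk_lengths x y m -> (n <= m)%N].

(* A one-way infinite path has a unique vertex of degree one, so it amounts to
   an injective sequence starting from that vertex. *)
Definition ray (r : nat -> V) := injective r /\ forall n, e (r n) (r n.+1).

Definition ray_equiv (r s : nat -> V) :=
  exists t : nat -> V, [/\ ray t,
    infinite_set (range t `&` range r) & infinite_set (range t `&` range s)].

Definition ends : set (set (nat -> V)) :=
  [set [set s | ray s /\ ray_equiv r s] | r in [set r | ray r]].

End Graphs.

Section LocalizationGame.
Variables (V : eqType) (e : rel V).

(* r n is the robber's position when the cops make their (n+1)-st probe. *)
Definition robber_play (r : nat -> V) :=
  forall n, r n.+1 = r n \/ e (r n) (r n.+1).

Section Cops.
(* The cops are indexed by a type, as their number may be an infinite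
   cardinal. *)
Variable K : Type.

(* The next probe depends on all the distances learned so far; the earlier
   probes need not be recorded since they are determined by these distances. *)
Definition strategy := seq (K -> nat) -> K -> V.

Definition probe (u : K -> V) (x : V) : K -> nat := fun i => dist e (u i) x.

Fixpoint answers (sigma : strategy) (r : nat -> V) (n : nat)
    : seq (K -> nat) :=
  if n is m.+1 then
    let h := answers sigma r m in rcons h (probe (sigma h) (r m))
  else [::].

(* After n+1 probes, all robber plays compatible with the answers are at the
   same current vertex. *)
Definition captured (sigma : strategy) (r : nat -> V) (n : nat) :=
  forall r', robber_play r' ->
    answers sigma r' n.+1 = answers sigma r n.+1 -> r' n = r n.

(* The robber being omniscient, a winning strategy has to capture him along
   every play; the number of rounds may depend on the play. *)
Definition cops_win :=
  exists sigma : strategy,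
    forall r, robber_play r -> exists n, captured sigma r n.

End Cops.

(* The cardinality of K is the localization number. *)
Definition is_localization_number (K : Type) :=
  cops_win K /\ forall K' : Type, cops_win K' -> [set: K] #<= [set: K'].

End LocalizationGame.

(* Main.v *)
(* Root the tree at v0. Call a vertex c confining if two cops win as soon as the
   robber is known to be strictly below c, at bounded level. One cop probing at
   w prevents the robber from changing branches at w, while the other one
   probes the children of w in turn; so if the children of w off a path from v
   to a deep vertex q are all confining, for every w on that path, then so is v,
   by first probing v and q. Hence below a non-confining vertex there are
   non-confining vertices at all levels (otherwise any long path would do), and
   two incomparable ones (otherwise take for q a deep non-confining vertex). If
   v0 were not confining, this would produce a binary tree of non-confining
   vertices, in which a ray can be chosen to avoid any countable list of
   ends. *)

Require Import Defs.
From mathcomp Require Import all_boot.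
From mathcomp Require Import zify.
From mathcomp Require Import boolp classical_sets functions cardinality.

Set Implicit Arguments.
Unset Strict Implicit.
Unset Printing Implicit Defensive.

Local Open Scope classical_set_scope.
Local Open Scope card_scope.

(** * Graph distance as the least length of a walk *)

Section Distance.
Variables (V : eqType) (e : rel V).
Hypothesis conn : connected_graph e.

Lemma dist_minimal x y : walk_lengths e x y (dist e x y) /\
  forall m, walk_lengths e x y m -> dist e x y <= m.
Proof.
have [_ /(_ x y) [k wk]] := conn.
have ex : exists n, `[< walk_lengths e x y n >] by exists k; apply/asboolP.
case: (ex_minnP ex) => n /asboolP wn nmin.
apply: (@xgetI _ 0 [set n | walk_lengths e x y n /\
  forall m, walk_lengths e x y m -> n <= m] n).
by split=> // m wm; apply/nmin/asboolP.
Qed.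

Lemma distP x y :
  exists p, [/\ path e x p, last x p = y & size p = dist e x y].
Proof. by have [] := dist_minimal x y. Qed.

Lemma dist_le_size x p : path e x p -> dist e x (last x p) <= size p.
Proof.
by move=> xp; have [_] := dist_minimal x (last x p); apply; exists p.
Qed.

Lemma dist_refl x : dist e x x = 0.
Proof. by apply/eqP; rewrite -leqn0; apply: (@dist_le_size x [::]). Qed.

Lemma dist_eq0 x y : dist e x y = 0 -> x = y.
Proof. by have [p [_ <- <-]] := distP x y => /size0nil->. Qed.

Lemma dist_consl x y z : e x y -> dist e x z <= (dist e y z).+1.
Proof.
move=> exy; have [p [yp <- <-]] := distP y z.
by apply: (@dist_le_size x (y :: p)); rewrite /= exy.
Qed.

Lemma dist_consr x y z : e y z -> dist e x z <= (dist e x y).+1.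
Proof.
move=> eyz; have [p [xp py <-]] := distP x y.
rewrite -(size_rcons p z) -[X in dist e x X](last_rcons x p).
by apply: dist_le_size; rewrite rcons_path xp py.
Qed.

End Distance.

(** * Rooted trees: levels, parents, ancestors and distances *)

Section RootedTree.
Variables (V : eqType) (e : rel V) (v0 : V).
Hypothesis treeT : tree e.

Let e_sym : symmetric e. Proof. by case: treeT => -[]. Qed.
Let e_irr : irreflexive e. Proof. by case: treeT => -[]. Qed.
Let conn : connected_graph e. Proof. by case: treeT. Qed.
Let acyc : acyclic e. Proof. by case: treeT. Qed.

Definition level x := dist e v0 x.

Lemma level_root : level v0 = 0.
Proof. exact: dist_refl. Qed.

Lemma level_eq0 x : level x = 0 -> x = v0.
Proof. by move/(dist_eq0 conn). Qed.

Lemma level_gt0 x : x != v0 -> 0 < level x.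
Proof. by rewrite lt0n; apply: contra => /eqP/level_eq0->. Qed.

Lemma level_edge x y : e x y -> level y <= (level x).+1.
Proof. exact: dist_consr. Qed.

Lemma lower_neighbor x n : level x = n.+1 -> exists2 y, e y x & level y = n.
Proof.
move=> lx; have [p] := distP conn v0 x; rewrite -/(level x) lx.
case/lastP: p => [[] //|p z]; rewrite rcons_path last_rcons size_rcons.
move=> [/andP[vp ez] zx [sp]]; exists (last v0 p); first by rewrite -zx.
have := dist_le_size conn vp; rewrite -/(level _) sp => le1.
have := level_edge ez; rewrite zx lx ltnS => le2.
by apply/eqP; rewrite eqn_leq le1.
Qed.

(* Descending from both endpoints to lower neighbors either closes a cycle or
   extends the path to one at the previous level, down to the root. *)
Lemma no_path_above n a p : path e a p -> uniq (a :: p) -> p != [::] ->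
  level a = n -> level (last a p) = n -> ~ all (fun z => n <= level z) (a :: p).
Proof.
elim: n a p => [|n IHn] a p ap uap pn0 la lb above.
  move: uap pn0; case/lastP: p ap lb above => [//|p b] _.
  rewrite last_rcons => /level_eq0-> _; rewrite (level_eq0 la) /=.
  by rewrite mem_rcons mem_head.
have [a' ea' la'] := lower_neighbor la; have [b' eb' lb'] := lower_neighbor lb.
have low z : level z = n -> z \notin a :: p.
  by move=> lz; apply/negP => /(allP above); rewrite lz ltnn.
have [ab|ab] := eqVneq a' b'.
  apply: (acyc (c := [:: a', a & p])); first by case: (p) pn0.
  apply/andP; split; last by rewrite cons_uniq low.
  by rewrite /= ea' rcons_path ap ab e_sym eb'.
apply: (IHn a' (rcons (a :: p) b')) => //=.
- by rewrite ea' rcons_path ap e_sym eb'.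
- rewrite -rcons_cons mem_rcons inE (negbTE ab) low //=.
  by rewrite -[_ && _]/(uniq (rcons (a :: p) b')) rcons_uniq low.
- by rewrite last_rcons.
- rewrite la' leqnn /= la leqnSn all_rcons lb' leqnn /=.
  by case/andP: above => _; apply: sub_all => z /ltnW.
Qed.

(** By the default value the root is its own parent. [{classic V}] gives the choice structure that
    [xget] asks for. *)
Definition parent (x : V) : V :=
  xget (x : {classic V}) [set y : {classic V} | e x y /\ level y < level x].

Lemma parentP x : x != v0 -> e x (parent x) /\ level x = (level (parent x)).+1.
Proof.
move=> /level_gt0 lx; have := lower_neighbor (esym (prednK lx)) => -[y ey ly].
have [|exp lp] := @xgetI {classic V} x
    [set y | e x y /\ level y < level x] y.
  by split; [rewrite e_sym | rewrite ly prednK].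
split=> //; apply/eqP; rewrite eqn_leq lp andbT.
by apply: level_edge; rewrite e_sym.
Qed.

Lemma parent_root : parent v0 = v0.
Proof. by apply: (@xgetPN {classic V}) => y [_]; rewrite level_root. Qed.

(** A second lower neighbor of a vertex, or an edge within a level, would give a path excluded by
    [no_path_above]. *)
Lemma parent_edge x y : e x y ->
  (x != v0 /\ y = parent x) \/ (y != v0 /\ x = parent y).
Proof.
have lower z t : e z t -> level t < level z -> z != v0 /\ t = parent z.
  move=> ezt lt; have z0 : z != v0.
    by apply: contraTneq lt => ->; rewrite level_root.
  split=> //; have [ezp lp] := parentP z0; apply/eqP/negPn/negP => tp.
  have lt' : level t = level (parent z).
    apply/eqP; rewrite eqn_leq -ltnS -lp lt /= -ltnS -lp.
    by apply: level_edge; rewrite e_sym.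
  have zt : t != z by apply: contraTneq lt => ->; rewrite ltnn.
  have zp : z != parent z.
    by apply/eqP => E; have := e_irr z; rewrite {2}E ezp.
  apply: (@no_path_above (level t) t [:: z; parent z]) => //=.
  - by rewrite e_sym ezt ezp.
  - by rewrite !inE negb_or zt tp zp.
  - by rewrite -lt' leqnn ltnW.
move=> exy; have [lt|lt|E] := ltngtP (level x) (level y).
- by right; apply: lower => //; rewrite e_sym.
- by left; apply: lower.
- case: (@no_path_above (level x) x [:: y]) => //=.
  + by rewrite exy.
  + by rewrite inE andbT; apply: contraTneq exy => ->; rewrite e_irr.
  + by rewrite E leqnn.
Qed.

Lemma level_iter n x : level (iter n parent x) = level x - n.
Proof.
elim: n => [|n IHn]; first by rewrite subn0.
rewrite iterS; have [E|/parentP[_]] := eqVneq (iter n parent x) v0; last by lia.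
by rewrite E parent_root; move: IHn; rewrite E level_root; lia.
Qed.

(** Truncated subtraction makes this false when [a] is deeper than [x]. *)
Definition anc a x := iter (level x - level a) parent x == a.

Lemma anc_level a x : anc a x -> level a <= level x.
Proof. by move=> /eqP/(congr1 level); rewrite level_iter; lia. Qed.

Lemma anc_refl x : anc x x.
Proof. by rewrite /anc subnn. Qed.

Lemma anc_root x : anc v0 x.
Proof. by apply/eqP/level_eq0; rewrite level_iter level_root; lia. Qed.

Lemma anc_iter n x : anc (iter n parent x) x.
Proof.
rewrite /anc level_iter; have [le|/ltnW le] := leqP n (level x).
  by rewrite subKn.
have E m : level x <= m -> iter m parent x = v0.
  by move=> lem; apply: level_eq0; rewrite level_iter; apply/eqP.
by rewrite !E //; lia.
Qed.

Lemma anc_parent x : anc (parent x) x.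
Proof. exact: (anc_iter 1). Qed.

Lemma anc_trans b a x : anc a b -> anc b x -> anc a x.
Proof.
move=> ab bx; have := anc_level ab; have := anc_level bx => lb la.
apply/eqP; rewrite -{2}(eqP ab) -{2}(eqP bx) -iterD; congr (iter _ _ _); lia.
Qed.

Lemma anc_total a b x : anc a x -> anc b x -> level a <= level b -> anc a b.
Proof.
move=> ax bx; have := anc_level ax; have := anc_level bx => lb la le.
apply/eqP; rewrite -{2}(eqP bx) -{2}(eqP ax) -iterD; congr (iter _ _ _); lia.
Qed.

Lemma anc_eq a b x : anc a x -> anc b x -> level a = level b -> a = b.
Proof. by move=> /eqP ax /eqP bx E; rewrite -ax -bx E. Qed.

Lemma anc_lt a x : anc a x -> a != x -> level a < level x.
Proof.
move=> ax; rewrite ltn_neqAle (anc_level ax) andbT; apply: contra_neq => E.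
exact: anc_eq ax (anc_refl x) E.
Qed.

Lemma anc_parentW a x : anc a x -> a != x -> anc a (parent x).
Proof.
move=> ax ne; have lt := anc_lt ax ne; apply: anc_total ax (anc_parent x) _.
have x0 : x != v0 by apply: contraTneq lt => ->; rewrite level_root.
by have [_ E] := parentP x0; move: lt; rewrite E.
Qed.

Lemma anc_child w y : anc w y -> w != y ->
  exists c, [/\ c != v0, parent c = w & anc c y].
Proof.
move=> wy ne; have lt := anc_lt wy ne.
exists (iter (level y - level w).-1 parent y); split; last exact: anc_iter.
  by apply/eqP => /(congr1 level); rewrite level_iter level_root; lia.
rewrite -iterS prednK; [exact/eqP | lia].
Qed.

Lemma child_level c : c != v0 -> level c = (level (parent c)).+1.
Proof. by case/parentP. Qed.

Lemma anc_exit a x y : e x y -> anc a x -> ~~ anc a y -> x = a /\ y = parent a.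
Proof.
move=> exy ax nay; case: (parent_edge exy) => -[_ E]; last first.
  by case/negP: nay; apply: anc_trans ax _; rewrite E; apply: anc_parent.
have [-> //|ne] := eqVneq a x.
by rewrite E anc_parentW in nay.
Qed.

Lemma dist_desc a x : anc a x -> dist e a x = level x - level a.
Proof.
move=> ax; apply/eqP; rewrite eqn_leq; apply/andP; split; last first.
  have [p [ap <- <-]] := distP conn a x.
  elim: p a ap {ax} => [|b p IHp] a /=; first by rewrite subnn.
  by case/andP=> /level_edge lab /IHp; lia.
move: {2}(level x - level a) (erefl (level x - level a)) => n.
elim: n x ax => [|n IHn] x ax E.
  have -> : x = a by apply/eqP/negPn/negP; rewrite eq_sym => /(anc_lt ax); lia.
  by rewrite dist_refl.
have ne : a != x by apply: contra_eq_neq E => ->; rewrite subnn.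
have x0 : x != v0 by apply: contra_eq_neq E => ->; rewrite level_root.
have [exp lp] := parentP x0; have := IHn _ (anc_parentW ax ne).
have : dist e a x <= (dist e a (parent x)).+1.
  by apply: dist_consr => //; rewrite e_sym.
by move=> le1 /(_ ltac:(lia)); lia.
Qed.

(** A walk from [x] to a vertex not below it has to leave the subtree of [x], which by [anc_exit]
    means passing through the parent. *)
Lemma dist_nondesc x y : ~~ anc x y -> dist e x y = (dist e (parent x) y).+1.
Proof.
move=> nxy; have x0 : x != v0 by apply: contraNneq nxy => ->; apply: anc_root.
have [exp _] := parentP x0.
apply/eqP; rewrite eqn_leq dist_consl //=.
have [p [xp py <-]] := distP conn x y.
suff gen z : anc x z -> path e z p -> last z p = y ->
    dist e (parent x) y < size p by apply: (gen x); rewrite ?anc_refl.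
elim: p z {xp py} => [|z' p IHp] z xz /=.
  by move=> _ E; rewrite -E xz in nxy.
case/andP=> ez pz' E; have [xz'|nxz'] := boolP (anc x z').
  exact/leqW/(IHp z').
by have [_ <-] := anc_exit ez xz nxz'; rewrite ltnS -E dist_le_size.
Qed.

(** The vertex [m] is where the paths from [v] to [q] and to [y] part; it is found by moving [q] up
    until it is an ancestor of [y]. *)
Lemma meetP v q y : anc v q -> anc v y ->
  exists m, [/\ anc v m, anc m q, anc m y,
    dist e q y = (level q - level m) + (level y - level m) &
    forall c, c != v0 -> parent c = m -> anc c q -> ~~ anc c y].
Proof.
move=> vq vy; move: {2}(level q - level v) (erefl (level q - level v)) => n.
elim: n q vq => [|n IHn] q vq E.
all: have [qy|nqy] := boolP (anc q y); first (exists q; split=> //;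
  [exact: anc_refl | by rewrite dist_desc // subnn
  |by move=> c c0 <- /anc_level; rewrite (child_level c0) ltnn]).
  have vEq : v = q by apply/eqP/negPn/negP => /(anc_lt vq); lia.
  by rewrite -vEq vy in nqy.
have q0 : q != v0 by apply: contraNneq nqy => ->; apply: anc_root.
have ne : v != q by apply: contraNneq nqy => <-.
have lq := child_level q0.
have [|m [vm mq my dq sep]] := IHn (parent q) (anc_parentW vq ne); first by lia.
have := anc_level mq => lm.
exists m; split=> //; first exact: anc_trans mq (anc_parent q).
  by rewrite dist_nondesc // dq; lia.
move=> c c0 cm cq; have [->//|ne'] := eqVneq c q.
by apply: sep => //; apply: anc_parentW.
Qed.

End RootedTree.

(** * The game played on sets of possible positions *)

Section KnowledgeGame.
Variables (V : eqType) (e : rel V) (K : Type).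

Definition after_move (X : set V) : set V :=
  [set y | exists2 x, X x & y = x \/ e x y].

(* [X] is the set of possible positions of the robber right after a probe. *)
Inductive locatable : set V -> Prop :=
| located X of (forall x y, X x -> X y -> x = y) : locatable X
| probing X (u : K -> V) of
    (forall a, locatable [set y | probe e u y = a /\ after_move X y]) :
    locatable X.

(** A derivation of [locatable] lives in [Prop]; a plan holds the same well-founded tree of probes
    as data, from which a strategy can be computed. *)
Inductive plan := Stop | Ask of (K -> V) & ((K -> nat) -> plan).

Fixpoint plan_works (t : plan) (X : set V) : Prop :=
  match t with
  | Stop => forall x y, X x -> X y -> x = y
  | Ask u k => forall a,
      plan_works (k a) [set y | probe e u y = a /\ after_move X y]
  end.

Lemma locatable_plan X : locatable X -> exists t, plan_works t X.
Proof.
elim=> {X} [X Xsub|X u _ /choice[k kP]]; first by exists Stop.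
by exists (Ask u k).
Qed.

Fixpoint subplan (t : plan) (h : seq (K -> nat)) {struct h} :
    plan :=
  match h, t with
  | a :: h', Ask _ k => subplan (k a) h'
  | _, _ => t
  end.

Lemma subplan_rcons t h u k a :
  subplan t h = Ask u k -> subplan t (rcons h a) = k a.
Proof. by elim: h t => [|b h IHh] [|u' k'] //= => [[_ ->]|/IHh]. Qed.

Definition plan_strategy (v : V) (t : plan) : strategy V K :=
  fun h => if subplan t h is Ask u _ then u else fun=> v.

(** Following the plan, its current set contains the positions of all plays with the answers heard
    so far; the plan is well-founded, so it reaches [Stop]. *)
Lemma cops_win_locatable : [set: V] !=set0 -> locatable [set: V] ->
  cops_win e K.
Proof.
move=> [v _] /locatable_plan[t works]; exists (plan_strategy v t) => r playr.
pose h r n := answers e (plan_strategy v t) r n.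
(* For [n = 0] the predecessor is 0, as if the robber had stayed put before the
   first probe. *)
suff gen s n X : subplan t (h r n) = s -> plan_works s X ->
    (forall r', robber_play e r' -> h r' n = h r n -> X (r' n.-1)) ->
    exists m, captured e (plan_strategy v t) r m.
  exact: (gen t 0 setT).
elim: s n X => [|u k IHk] n X E worksX poss.
  exists n.-1 => r' playr' eqh; apply: worksX; last exact: poss.
  by apply: poss => //; case: (n) eqh.
apply: (IHk (probe e u (r n)) n.+1 _ _ (worksX _)).
  by rewrite /= (subplan_rcons _ E) /plan_strategy E.
move=> r' playr' /rcons_inj[eqh].
rewrite -!/(h _ _) eqh /plan_strategy E => eqp.
split=> //; exists (r' n.-1); first exact: poss.
by case: (n) => [|m]; [left | exact: playr'].
Qed.

End KnowledgeGame.

(** * Comparing numbers of cops *)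

Lemma cops_win_more (V : eqType) (e : rel V) (K K' : Type)
    (f : K -> K') (g : K' -> K) :
  cancel g f -> cops_win e K' -> cops_win e K.
Proof.
move=> gK [sigma win].
(* Cop [i] of [K] plays the role of cop [f i]; the answer to cop [j] of [K'] is read off cop
   [g j]. *)
pose restrict (a : K -> nat) := a \o g.
pose sigma' : strategy V K := fun h => sigma (map restrict h) \o f.
have restrict_answers r n :
    map restrict (answers e sigma' r n) = answers e sigma r n.
  elim: n => [//|n IHn]; rewrite /= map_rcons IHn; congr rcons.
  by apply/funext => i; rewrite /restrict /probe /sigma' /= gK -IHn.
exists sigma' => r /win[n capt]; exists n => r' playr' eqh.
by apply: capt => //; rewrite -!restrict_answers eqh.
Qed.

(** Take the least winning natural number. An infinite set of cops is at least as large, and a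
    finite one is in bijection with some ['I_k], to which its win transfers. *)
Lemma localization_number_le (V : eqType) (e : rel V) n :
  cops_win e 'I_n -> exists2 m, m <= n & is_localization_number e 'I_m.
Proof.
move=> winn.
have ex : exists m, `[< cops_win e 'I_m >] by exists n; apply/asboolP.
case: (ex_minnP ex) => m /asboolP winm minm; exists m.
  exact/minm/asboolP.
split=> // K winK; have [fin|inf] := pselect (finite_set [set: K]); last first.
  apply: card_le_trans (proj1 (infiniteP _) inf).
  by apply/pcard_injP; exists (@nat_of_ord m) => i j _ _ /val_inj.
have /finite_setP[k eqK] := fin.
have lemk : m <= k.
  apply/minm/asboolP; move: (eqK); rewrite (card_eqr card_II).
  move=> /card_bijP[f [g gK fK]].
  apply: (@cops_win_more _ _ _ _ (val \o g \o to_setT)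
    (val \o f \o to_setT)) winK => x /=.
  by rewrite [to_setT _](_ : _ = f (to_setT x)) ?gK //; apply/val_inj.
rewrite (card_le_eqr eqK) -(card_le_eql card_II).
by rewrite card_le_II.
Qed.

(** * Confining vertices and the capture of the robber *)

Section Capture.
Variables (V : eqType) (e : rel V) (v0 : V).
Hypothesis treeT : tree e.
Hypothesis lf : locally_finite e.

Let e_sym : symmetric e. Proof. by case: treeT => -[]. Qed.
Let conn : connected_graph e. Proof. by case: treeT. Qed.

Local Notation level := (level e v0).
Local Notation parent := (parent e v0).
Local Notation anc := (anc e v0).
Local Notation locatable := (@locatable V e 'I_2).

Lemma probing_pair (X : set V) u w :
  (forall a b, locatable
    [set y | [/\ dist e u y = a, dist e w y = b & after_move e X y]]) ->
  locatable X.
Proof.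
move=> loc.
apply: (@probing _ _ _ _ (fun i : 'I_2 => if i == ord0 then u else w)) => a.
rewrite [X in locatable X](_ : _ = [set y |
  [/\ dist e u y = a ord0, dist e w y = a ord_max & after_move e X y]]) //.
apply/seteqP; split=> y /=.
  by move=> [pa aX]; rewrite -pa.
move=> [ua wa aX]; split=> //; apply/funext => i; rewrite /probe.
case: eqVneq => [->//|i0]; rewrite wa; congr a.
by apply/val_inj; case: i i0 => -[|[|]].
Qed.

(* The height of the robber is bounded since the first probe at the root; it
   tells how deep the next probe has to be. *)
Definition confining c := forall d (X : set V),
  (forall y, X y -> [/\ anc c y, c != y & level y <= d]) -> locatable X.

(* Probing [w] all the time keeps the robber in a single branch at [w], which
   is found by probing the children one after the other. *)
Lemma locate_branch w (cs : seq V) (X : set V) :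
  (forall c, c \in cs -> [/\ c != v0, parent c = w & confining c]) ->
  (forall y, X y -> exists2 c, c \in cs & anc c y) -> locatable X.
Proof.
elim: cs X => [|c cs IHcs] X good cov.
  by apply: located => x y /cov[].
have [c0 cw goodc] := good c (mem_head c cs).
apply: (@probing_pair _ w c) => a b; set Y := (X in locatable X).
have [a0|apos] := posnP a.
  apply: located => x y [+ _ _] [+ _ _].
  by rewrite a0 => /(dist_eq0 conn)<- /(dist_eq0 conn)<-.
have covY y : Y y -> exists2 c', c' \in c :: cs & anc c' y.
  move=> [wy _ [x Xx move_xy]]; have [c' c'cs c'x] := cov x Xx.
  case: move_xy => [->|exy]; first by exists c'.
  exists c' => //; apply/negPn/negP => nc'y.
  have [_ yE] := anc_exit treeT exy c'x nc'y; have [_ c'w _] := good c' c'cs.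
  by move: apos; rewrite -wy yE c'w dist_refl.
have ancw c' y : parent c' = w -> anc c' y -> anc w y.
  by move=> <-; apply/anc_trans/anc_parent.
have lc := child_level treeT c0; rewrite cw in lc.
(* Vertices below [c] are one step nearer to [c] than to [w], all others one step farther, so this
   test decides whether the robber is below [c]. *)
have [ab|nab] := eqVneq a b.+1; last first.
  apply: IHcs => [c' c'cs|y Yy]; first by apply: good; rewrite inE c'cs orbT.
  have [c' + c'y] := covY y Yy; rewrite inE => /predU1P[E|]; last by exists c'.
  move: nab c'y; have [<- <- _] := Yy; rewrite {}E => nab cy.
  case/eqP: nab.
  rewrite (dist_desc treeT (ancw c y cw cy)) (dist_desc treeT cy).
  by have := anc_level treeT cy; lia.
have Yc y : Y y -> anc c y.
  move=> Yy; apply/negPn/negP => ncy; have [wy cy _] := Yy.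
  by have := dist_nondesc treeT ncy; rewrite cw wy cy; lia.
have [b0|bpos] := posnP b.
  apply: located => x y [_ + _] [_ + _].
  by rewrite b0 => /(dist_eq0 conn)<- /(dist_eq0 conn)<-.
apply: (goodc (level c + b)) => y Yy; have [_ cyb _] := Yy.
split; first exact: Yc.
  by apply: contraTneq bpos => E; rewrite -cyb E dist_refl.
by move: cyb; rewrite (dist_desc treeT (Yc y Yy)); lia.
Qed.

(* The probes at [v] and [q] tell where the path to the robber leaves the one
   from [v] to [q], as [q] is a leaf or too deep for the robber to be
   below it. *)
Lemma confining_path v :
  (forall d, exists q, [/\ anc v q,
     d <= level q \/ (forall c, c != v0 -> parent c != q) &
     forall c, c != v0 -> anc v (parent c) -> anc (parent c) q ->
       parent c != q -> ~~ anc c q -> confining c]) ->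
  confining v.
Proof.
(* After his next move the robber has level at most [d.+1], so level [d.+2] puts [q] strictly deeper
   than he is. *)
move=> paths d X XP; have [q [vq deep good]] := paths d.+2.
apply: (@probing_pair _ v q) => a b; set Y := (X in locatable X).
have YP y : Y y -> anc v y /\ level y <= d.+1.
  move=> [_ _ [x /XP[vx ne lx] [->|exy]]]; first by split=> //; lia.
  split; last by have := level_edge v0 treeT exy; lia.
  apply/negPn/negP => nvy.
  by have [E _] := anc_exit treeT exy vx nvy; rewrite E eqxx in ne.
have [[y0 Yy0]|Y0] := pselect (exists y, Y y); last first.
  by apply: located => x y Yx; case: Y0; exists x.
have [vy0 _] := YP y0 Yy0.
have [m [vm mq my0 dq0 _]] := meetP treeT vq vy0.
have levY y : Y y -> level y = level v + a.
  move=> Yy; have [vy _] := YP y Yy; have [<- _ _] := Yy.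
  by rewrite (dist_desc treeT vy); have := anc_level treeT vy; lia.
(* All candidates have the same level, so the distance from [q] determines the level of the meeting
   vertex, hence that vertex on the path from [v] to [q]. *)
have meetm y : Y y -> anc m y /\
    forall c, c != v0 -> parent c = m -> anc c y -> ~~ anc c q.
  move=> Yy; have [vy _] := YP y Yy.
  have [m' [_ m'q m'y dq sep]] := meetP treeT vq vy.
  have E : m = m'.
    apply: (anc_eq mq m'q).
    have [_ qy _] := Yy; have [_ qy0 _] := Yy0.
    have := levY y Yy; have := levY y0 Yy0; move: dq dq0; rewrite qy qy0.
    have := anc_level treeT mq; have := anc_level treeT m'q.
    by have := anc_level treeT my0; have := anc_level treeT m'y; lia.
  by subst m'; split=> // c c0 cm cy; apply: contraTN cy; apply: sep.
have [aE|am] := eqVneq (level v + a) (level m).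
  apply: located => x y Yx Yy.
  have below z : Y z -> m = z.
    move=> Yz; have [mz _] := meetm z Yz; apply: (anc_eq mz) => //.
      exact: anc_refl.
    by rewrite (levY z Yz) aE.
  by rewrite -(below x Yx) -(below y Yy).
have /finite_seqP[s sE] := lf m.
have below y : Y y -> exists c, [/\ c != v0, parent c = m & anc c y].
  move=> Yy; have [my _] := meetm y Yy; apply: anc_child => //.
  by apply: contraNneq am => E; rewrite -(levY y Yy) -E.
have mNq : m != q.
  have [c [c0 cm cy0]] := below y0 Yy0.
  case: deep => [deep|/(_ c c0)]; last by rewrite cm.
  apply: contraTneq deep => <-; have [_] := YP y0 Yy0.
  by have := anc_level treeT my0; lia.
pose cs := [seq c <- s | [&& c != v0, parent c == m & ~~ anc c q]].
apply: (@locate_branch m cs) => [c|y Yy].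
  rewrite mem_filter => /andP[/and3P[c0 /eqP cm ncq] _].
  by split=> //; apply: good; rewrite ?cm.
have [c [c0 cm cy]] := below y Yy; exists c => //.
have [_ /(_ c c0 cm cy) ncq] := meetm y Yy.
rewrite mem_filter c0 cm eqxx ncq /=.
suff : [set` s] c by [].
by rewrite -sE /= e_sym -cm; have [] := parentP treeT c0.
Qed.

Lemma locatable_root : confining v0 -> locatable [set: V].
Proof.
move=> good; apply: (@probing_pair _ v0 v0) => a b.
have [->|apos] := posnP a.
  apply: located => x y [+ _ _] [+ _ _].
  by move=> /(dist_eq0 conn)<- /(dist_eq0 conn)<-.
apply: (good a) => y [ya _ _]; split; first exact: anc_root.
  by apply: contraTneq apos => E; rewrite -ya -E dist_refl.
by rewrite /level ya.
Qed.

(** If all vertices strictly below [v] were confining, [confining_path] would apply with [q] at the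
    end of any path from [v] down to level [d], or to a leaf before. *)
Lemma below_nonconfining v : ~ confining v ->
  exists b, [/\ anc v b, v != b & ~ confining b].
Proof.
move=> bad; apply: contrapT => nex; apply: bad; apply: confining_path => d.
have good c : c != v0 -> anc v (parent c) -> confining c.
  move=> c0 vpc; apply: contrapT => badc; apply: nex; exists c; split=> //.
    exact/(anc_trans treeT vpc)/anc_parent.
  have := anc_level treeT vpc; have := child_level treeT c0.
  by move=> lc; apply: contraTneq => ->; rewrite lc ltnn.
suff [q [vq lq]] : exists q, anc v q /\
    (d <= level q \/ forall c, c != v0 -> parent c != q).
  by exists q; split=> // c c0 vpc _ _ _; apply: good.
elim: d => [|d [q [vq [lq|leaf]]]].
- by exists v; split; [exact: anc_refl | left].
- have [[c [c0 cq]]|nc] := pselect (exists c, c != v0 /\ parent c = q).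
    exists c; split; last by left; rewrite (child_level treeT c0) cq.
    by apply: (anc_trans treeT vq); rewrite -cq; apply: anc_parent.
  exists q; split=> //; right=> c c0; apply/eqP => cq; apply: nc.
  by exists c.
- by exists q; split=> //; right.
Qed.

Lemma deep_nonconfining v d : ~ confining v ->
  exists b, [/\ anc v b, d <= level b & ~ confining b].
Proof.
move=> bad; elim: d => [|d [b [vb lb badb]]].
  by exists v; split=> //; apply: anc_refl.
have [c [bc ne badc]] := below_nonconfining badb.
exists c; split=> //; first exact: anc_trans bc.
exact: leq_ltn_trans lb (anc_lt treeT bc ne).
Qed.

(** For a deep non-confining [q], a non-confining child off the path to [q] is incomparable with
    [q]. Without such pairs, [confining_path] would make [v] confining. *)
Lemma branching_nonconfining v : ~ confining v ->
  exists a b, [/\ anc v a, anc v b, ~~ anc a b, ~~ anc b a &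
    ~ confining a /\ ~ confining b].
Proof.
move=> bad; apply: contrapT => nex; apply: (bad); apply: confining_path => d.
have [q [vq lq badq]] := deep_nonconfining d bad.
exists q; split=> // [|c c0 vpc pcq ne ncq]; first by left.
apply: contrapT => badc; apply: nex; exists c, q; split=> //.
  exact/(anc_trans treeT vpc)/anc_parent.
(* Were [q] an ancestor of [c], then, being strictly below the parent of [c], it would be [c]
   itself. *)
have lpq := anc_lt treeT pcq ne; apply/negP => qc.
have := anc_level treeT qc; rewrite (child_level treeT c0) => lqc.
have E : level q = level c by rewrite (child_level treeT c0); lia.
by case/negP: ncq; rewrite (anc_eq qc (anc_refl _ _ _) E) anc_refl.
Qed.

End Capture.

(** * Rays, ends and branching sets of vertices *)

Section Ends.
Variables (V : eqType) (e : rel V) (v0 : V).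
Hypothesis treeT : tree e.

Let e_sym : symmetric e. Proof. by case: treeT => -[]. Qed.

Local Notation level := (level e v0).
Local Notation parent := (parent e v0).
Local Notation anc := (anc e v0).

Definition eventually_below a (r : nat -> V) :=
  exists N, forall n, N <= n -> anc a (r n).

Lemma ray_equiv_refl r : ray e r -> ray_equiv e r r.
Proof.
move=> rayr; have [rinj _] := rayr; exists r; split=> //; rewrite setIid.
all: apply/infiniteP; rewrite (card_le_eqr (inj_card_eq _)) //.
all: by move=> i j _ _ /rinj.
Qed.

Lemma exit_at a (t : nat -> V) n n' : (forall i, e (t i) (t i.+1)) ->
  n <= n' -> anc a (t n) -> ~~ anc a (t n') -> exists2 i, n <= i < n' & t i = a.
Proof.
move=> et; elim: n' => [|n' IHn'].
  by rewrite leqn0 => /eqP-> ->.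
rewrite leq_eqVlt => /predU1P[-> -> //|lenn'] an nan'.
have [an'|/(IHn' lenn' an)[i /andP[lei lti] ti]] := boolP (anc a (t n')).
  have [<- _] := anc_exit treeT (et n') an' nan'.
  by exists n'; rewrite // -ltnS lenn' leqnn.
by exists i; rewrite // lei ltnS ltnW.
Qed.

(** Only finitely many common vertices have index below [N] on [t] or an index below [M] on [r]. *)
Lemma visits_below a r t : injective t -> eventually_below a r ->
  infinite_set (range t `&` range r) ->
  forall N, exists2 n, N <= n & anc a (t n).
Proof.
move=> tinj [M below] inf N; apply: contrapT => nex; apply: inf.
apply: (@sub_finite_set _ _ ((t @` `I_N) `|` (r @` `I_M))); last first.
  by rewrite finite_setU; split; apply: finite_image.
move=> _ [[n _ <-] [m _ rm]]; have [lt|le] := ltnP n N; first by left; exists n.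
right; exists m => //=; rewrite ltnNge; apply/negP => leMm.
by apply: nex; exists n => //; rewrite -rm; apply: below.
Qed.

(* A ray visiting the subtrees below two incomparable vertices infinitely often
   would have to leave the first one twice through its root. *)
Lemma ray_equiv_comparable a b r s : ray_equiv e r s ->
  eventually_below a r -> eventually_below b s -> anc a b || anc b a.
Proof.
move=> [t [[tinj et] tr ts]] ar bs; apply/negPn/negP; rewrite negb_or.
case/andP=> nab nba.
have disj x : anc b x -> ~~ anc a x.
  move=> bx; apply/negP => ax; have [le|/ltnW le] := leqP (level a) (level b).
    by rewrite (anc_total treeT ax bx le) in nab.
  by rewrite (anc_total treeT bx ax le) in nba.
have leave N : exists2 i, N <= i & t i = a.
  have [n len an] := visits_below tinj ar tr N.
  have [n' len' /disj nan'] := visits_below tinj bs ts n.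
  have [i /andP[lei _] ti] := exit_at et len' an nan'.
  by exists i; [exact: leq_trans len lei|].
have [i _ ti] := leave 0; have [j ltij tj] := leave i.+1.
by have := tinj i j; rewrite ti tj => /(_ erefl) E; rewrite E ltnn in ltij.
Qed.

Lemma ray_through (w : nat -> V) :
  (forall n, anc (w n) (w n.+1) /\ level (w n) < level (w n.+1)) ->
  exists2 r, ray e r & forall n, eventually_below (w n) r.
Proof.
move=> mono.
have wanc m n : m <= n -> anc (w m) (w n).
  elim: n => [|n IHn]; first by rewrite leqn0 => /eqP->; apply: anc_refl.
  rewrite leq_eqVlt => /predU1P[->|/IHn an]; first exact: anc_refl.
  by apply: anc_trans an _ => //; have [] := mono n.
have wlev n : n <= level (w n).
  by elim: n => // n IHn; have [_] := mono n; apply: leq_ltn_trans.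
(* The ray starts at the root; its vertex on level [k] is the ancestor of [w k], whose level is at
   least [k]. *)
pose r k := iter (level (w k) - k) parent (w k).
have rlev k : level (r k) = k by rewrite level_iter // subKn.
have ranc k n : k <= n -> anc (r k) (w n).
  by move=> /wanc; apply: anc_trans => //; apply: anc_iter.
exists r.
  split=> [i j /(congr1 level)|n]; first by rewrite !rlev.
  have r0 : r n.+1 != v0.
    by apply: contra_eq_neq (rlev n.+1) => ->; rewrite level_root.
  have [epar lev] := parentP treeT r0; rewrite e_sym.
  suff -> : r n = parent (r n.+1) by [].
  apply: (anc_eq (ranc n n.+1 (leqnSn n))).
    apply: (anc_trans treeT (anc_parent v0 treeT (r n.+1))).
    exact: ranc (leqnn _).
  by move: lev; rewrite !rlev => -[].
move=> n; exists (level (w n)) => k lek.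
apply: (anc_total treeT (wanc n (maxn n k) _) (ranc k (maxn n k) _)).
- exact: leq_maxl.
- exact: leq_maxr.
- by rewrite rlev.
Qed.

Definition end_of (r : nat -> V) : set (nat -> V) :=
  [set s | ray e s /\ ray_equiv e r s].

Lemma end_of_eq r s : ray e s -> end_of r = end_of s -> ray_equiv e r s.
Proof.
move=> rays E; suff [] : end_of r s by [].
by rewrite E; split=> //; apply: ray_equiv_refl.
Qed.

(** Diagonal argument: [f] numbers the ends, and step [n] goes down to a vertex of [P] below which
    no ray of end number [n] eventually stays. The ray through these vertices is left without a
    number. *)
Lemma countable_ends_no_branching (P : V -> Prop) : countable (ends e) ->
  (forall v, P v -> exists a b,
    [/\ anc v a, anc v b, ~~ anc a b, ~~ anc b a & P a /\ P b]) ->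
  forall v, ~ P v.
Proof.
move=> /countable_injP[f finj] branch v Pv.
have end_inj r s : ray e r -> ray e s -> f (end_of r) = f (end_of s) ->
    ray_equiv e r s.
  move=> rayr rays E; apply: end_of_eq => //; apply: finj => //; apply: mem_set.
    by exists r.
  by exists s.
have avoid (p : V * nat) : exists w, P p.1 ->
    [/\ anc p.1 w, level p.1 < level w, P w &
      forall r, ray e r -> eventually_below w r -> f (end_of r) != p.2].
  case: p => u n /=; have [/branch|] := pselect (P u); last by exists u.
  move=> [a [b [ua ub nab nba [Pa Pb]]]].
  have strict x y : anc u x -> anc u y -> ~~ anc x y -> level u < level x.
    move=> ux uy nxy; apply: (anc_lt treeT ux); apply: contraNneq nxy => <-.
    exact: uy.
  (* By [ray_equiv_comparable] the end numbered [n] cannot have rays eventually below both [a] and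
     [b]; one that it avoids is taken. *)
  have [[r [rayr ra rn]]|na] := pselect (exists r,
      [/\ ray e r, eventually_below a r & f (end_of r) = n]).
    exists b => _; split=> //; first exact: (strict b a).
    move=> s rays sb; apply/eqP => sn.
    have rs : ray_equiv e r s by apply: end_inj; rewrite // rn sn.
    by have := ray_equiv_comparable rs ra sb; rewrite (negbTE nab) (negbTE nba).
  exists a => _; split=> //; first exact: (strict a b).
  by move=> r rayr ra; apply/eqP => rn; apply: na; exists r.
have [g gP] := choice avoid.
pose w := fix w n := if n is m.+1 then g (w m, m) else v.
have Pw n : P (w n) by elim: n => // n IHn; have [] := gP (w n, n) IHn.
have [|r rayr rw] := @ray_through w.
  by move=> n; have [] := gP (w n, n) (Pw n).
(* The step whose index is the number of the end of [r] itself has excluded that end. *)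
have [_ _ _ /(_ r rayr (rw (f (end_of r)).+1)) /=] :=
  gP (w (f (end_of r)), f (end_of r)) (Pw _).
by rewrite eqxx.
Qed.

End Ends.

Theorem theorem2p5 (V : eqType) (e : rel V) :
  tree e -> locally_finite e -> countable (ends e) ->
  exists2 K : Type, is_localization_number e K & [set: K] #<= [set: 'I_2].
Proof.
move=> treeT lf count; have [_ [ne _] _] := treeT; have [v0 _] := ne.
have win : cops_win e 'I_2.
  apply: (cops_win_locatable ne); apply: (locatable_root (v0 := v0) treeT).
  apply: contrapT.
  apply: (countable_ends_no_branching (v0 := v0) treeT
    (P := fun v => ~ confining e v0 v) count) => v.
  exact: branching_nonconfining.
have [m lem num] := localization_number_le win; exists 'I_m => //.
by rewrite -(card_le_eql card_II) -(card_le_eqr card_II) card_le_II.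
Qed.
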